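(* Let $F$ be a field, let $G$ be a group (written additively, but not necessarily abelian), let $\mathbf{n}$ be a supernatural number, and let $1=n_0<n_1<n_2<\cdots$ be natural numbers with $n_t\mid n_{t+1}$ for all $t$ and $\operatorname{lcm}\{n_t\}=\mathbf{n}$. Every elementary $G$-grading of $\operatorname{M}_{\mathbf{n}}(F)$ is defined by $$\deg(e_{i_{t-1}\cdots i_0,\;i'_{t-1}\cdots i'_0})=h_{0,i_0}+h_{1,i_1}+\cdots+h_{t-1,i_{t-1}}-h_{t-1,i'_{t-1}}-\cdots-h_{1,i'_1}-h_{0,i'_0}$$ (for all $t \geq 0$ and all pairs of $\mathbf{n}$-adic words of length $t$), where $h_{t,j}\in G$ ($t\ge 0$, $0\le j<n_{t+1}/n_t$) are arbitrary elements.
   Context: A supernatural number is a formal product $\prod_p p^{\alpha_p}$ over the primes, with $\alpha_p\in\mathbb{N}\cup\{\infty\}$ ($0$ allowed). $\operatorname{M}_{\mathbf{n}}(F)=\varinjlim_t\operatorname{M}_{n_t}(F)$ is the direct limit along the diagonal embeddings $x\mapsto x\otimes 1=\operatorname{diag}(x,\dots,x)$. An $\mathbf{n}$-adic word of length $t$ is a sequence $i_{t-1}\cdots i_0$ with $0\le i_s<n_{s+1}/n_s$; it represents the number $i_0+i_1n_1+\cdots+i_{t-1}n_{t-1}\in\{0,\dots,n_t-1\}$, and for words $w,w'$ of length $t$, $e_{w,w'}$ is the corresponding matrix unit of $\operatorname{M}_{n_t}(F)\subseteq\operatorname{M}_{\mathbf{n}}(F)$. Thus $e_{w,w'}=\sum_{i=0}^{n_{t+1}/n_t-1}e_{iw,iw'}$,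 where $iw$ is $w$ with the digit $i$ added on the left. A $G$-grading of a matrix algebra $\operatorname{M}_n(F)$ is elementary if there are elements $g_0,\dots,g_{n-1}\in G$ such that every matrix unit $e_{ij}$ is homogeneous of degree $\deg(e_{ij})=g_i-g_j$. An elementary $G$-grading of $\operatorname{M}_{\mathbf{n}}(F)$ is a $G$-grading which induces an elementary grading on each of the subalgebras $\operatorname{M}_{n_t}(F)\subseteq\operatorname{M}_{\mathbf{n}}(F)$. The word ''arbitrary'' means that every elementary grading arises from some family $(h_{t,j})$ through the formula, with any family of elements of $G$ allowed. *)

(* Defs.v *)
From HB Require Import structures.
From mathcomp Require Import all_boot all_order all_algebra generic_quotient.

Set Implicit Arguments.
Unset Strict Implicit.
Unset Printing Implicit Defensive.

Import GRing.Theory.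

Local Open Scope ring_scope.
Local Open Scope quotient_scope.

(* Exponents: [Some k] is the finite exponent k, [None] is infinity. *)
Definition supernatural := {p : nat | prime p} -> option nat.

Definition supernat_of_nat (m : nat) : supernatural :=
  fun p => Some (logn (val p) m).

Definition leq_exponent (a b : option nat) : bool :=
  match a, b with
  | _, None => true
  | None, Some _ => false
  | Some k, Some l => (k <= l)%N
  end.

Definition supernat_dvd (a b : supernatural) : Prop :=
  forall p, leq_exponent (a p) (b p).

Definition is_supernat_lcm (u : nat -> nat) (N : supernatural) : Prop :=
  (forall t, supernat_dvd (supernat_of_nat (u t)) N) /\
  (forall N', (forall t, supernat_dvd (supernat_of_nat (u t)) N') ->
     supernat_dvd N N').

Record divisor_chain := DivisorChain {
  chain_val :> nat -> nat;
  chain0 : chain_val 0 = 1%N;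
  chain_lt : forall t, (chain_val t < chain_val t.+1)%N;
  chain_dvd : forall t, (chain_val t %| chain_val t.+1)%N
}.

Section Chain.

Variable n : divisor_chain.

Lemma chain_gt0 t : (0 < n t)%N.
Proof. by case: t => [|t]; [rewrite chain0 | apply: leq_ltn_trans (chain_lt n t)]. Qed.

Lemma chain_dvd_le s t : (s <= t)%N -> (n s %| n t)%N.
Proof.
move=> /subnK <-; elim: (t - s)%N => [|k IHk] //.
by rewrite addSn (dvdn_trans IHk) ?chain_dvd.
Qed.

(* Digits are indexed by their position: [w s] is i_s, the digit of weight
   n_s, so the word written i_(t-1) ... i_0 has its lowest digit at 0. *)
Definition word (t : nat) := forall s : 'I_t, 'I_(n s.+1 %/ n s).

Lemma word_bound t (w : word t) : (\sum_(s < t) w s * n s < n t)%N.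
Proof.
elim: t w => [|t IHt] w; first by rewrite big_ord0 chain0.
rewrite big_ord_recr /=.
have /= lt_low := IHt (fun s => w (widen_ord (leqnSn t) s)).
have /= lt_top := ltn_ord (w ord_max).
apply: (@leq_trans ((w ord_max).+1 * n t)).
  by rewrite mulSn -addSn leq_add2r.
by rewrite -[X in (_ <= X)%N](divnK (chain_dvd n t)) leq_mul2r lt_top orbT.
Qed.

Definition word_num t (w : word t) : 'I_(n t) := Ordinal (word_bound w).

End Chain.

Section DirectLimit.

Variables (F : fieldType) (n : divisor_chain).

Definition chain_mod (t i : nat) : 'I_(n t) :=
  Ordinal (ltn_pmod i (chain_gt0 n t)).

(* For t <= s this is the block matrix diag(x, ..., x) with n_s / n_t blocks. *)
Definition diag_emb (t s : nat) (x : 'M[F]_(n t)) : 'M[F]_(n s) :=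
  \matrix_(i, j)
    if (i %/ n t == j %/ n t)%N then x (chain_mod t i) (chain_mod t j) else 0.

Lemma chain_mod_id t (i : 'I_(n t)) : chain_mod t i = i.
Proof. by apply: val_inj; rewrite /= modn_small. Qed.

Lemma diag_emb_id t x : diag_emb t x = x :> 'M_(n t).
Proof.
by apply/matrixP=> i j; rewrite mxE !divn_small // eqxx !chain_mod_id.
Qed.

Lemma diag_emb_comp t s u (x : 'M[F]_(n t)) : (t <= s)%N ->
  diag_emb u (diag_emb s x) = diag_emb u x.
Proof.
move=> le_ts; apply/matrixP=> i j; rewrite !mxE /=.
have mod_ts a : chain_mod t (a %% n s) = chain_mod t a.
  by apply: val_inj; rewrite /= modn_dvdm // chain_dvd_le.
rewrite !mod_ts; set k := (n s %/ n t)%N.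
have Ek : n s = (k * n t)%N by rewrite divnK // chain_dvd_le.
have Ediv a : (a %/ n t = a %/ n s * k + a %% n s %/ n t)%N.
  rewrite {1}(divn_eq a (n s)) {2}Ek mulnA.
  by rewrite divnMDl ?chain_gt0.
have lt_k a : (a %% n s %/ n t < k)%N.
  by rewrite ltn_divLR ?chain_gt0 // -Ek ltn_pmod ?chain_gt0.
have k_gt0 : (0 < k)%N by apply: leq_ltn_trans (lt_k 0%N).
rewrite (Ediv i) (Ediv j).
have [->|ne_ij] := eqVneq (i %/ n s)%N (j %/ n s)%N; first by rewrite eqn_add2l.
case: eqP => // E; case/eqP: ne_ij.
have /(congr1 (divn^~ k)) := E.
by rewrite /= !divnMDl // (divn_small (lt_k i)) (divn_small (lt_k j)) !addn0.
Qed.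

Lemma diag_emb_is_linear t s : linear (@diag_emb t s).
Proof.
move=> a x y; apply/matrixP=> i j; rewrite !mxE.
by case: ifP => _; rewrite ?mulr0 ?addr0.
Qed.

HB.instance Definition _ t s :=
  GRing.isLinear.Build F 'M[F]_(n t) 'M[F]_(n s) *:%R (@diag_emb t s)
    (@diag_emb_is_linear t s).

Lemma diag_emb1 t s : diag_emb s (1%:M : 'M[F]_(n t)) = 1%:M.
Proof.
apply/matrixP=> i j; rewrite !mxE -!val_eqE /=.
have -> : (i == j :> nat) =
  (i %/ n t == j %/ n t)%N && (i %% n t == j %% n t)%N.
  apply/eqP/andP=> [->//|[/eqP Ed /eqP Em]].
  by rewrite (divn_eq i (n t)) (divn_eq j (n t)) Ed Em.
by case: (_ == _).
Qed.

Lemma diag_embM t s (x y : 'M[F]_(n t)) : (t <= s)%N ->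
  diag_emb s (x *m y) = diag_emb s x *m diag_emb s y.
Proof.
move=> le_ts; apply/matrixP=> i j; rewrite !mxE.
under [RHS]eq_bigr do rewrite !mxE.
case: ifP => [/eqP Eij | /eqP ne_ij]; last first.
  rewrite big1 // => l _.
  case: eqP => [El|]; rewrite ?mul0r //.
  by case: eqP => [El'|]; rewrite ?mulr0 //; case: ne_ij; rewrite El.
rewrite (bigID (fun l : 'I_(n s) => i %/ n t == l %/ n t)%N) /=.
rewrite [X in _ = _ + X]big1 ?addr0; last first.
  by move=> l /negbTE ->; rewrite mul0r.
have lt_emb (o : 'I_(n t)) : (i %/ n t * n t + o < n s)%N.
  have Ek : n s = (n s %/ n t * n t)%N by rewrite divnK // chain_dvd_le.
  apply: (@leq_trans ((i %/ n t).+1 * n t)).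
    by rewrite mulSn addnC ltn_add2r.
  by rewrite {2}Ek leq_mul2r ltn_divLR ?chain_gt0 // -Ek ltn_ord orbT.
have div_emb (o : 'I_(n t)) : ((i %/ n t * n t + o) %/ n t = i %/ n t)%N.
  by rewrite divnMDl ?chain_gt0 // (divn_small (ltn_ord o)) addn0.
rewrite (reindex_onto (fun o => Ordinal (lt_emb o)) (chain_mod t)) /=; last first.
  move=> l /eqP El; apply: val_inj; rewrite /= El.
  by rewrite -divn_eq.
apply: eq_big => [o|o _].
  rewrite div_emb eqxx /=; apply/esym/eqP; apply: val_inj => /=.
  by rewrite modnMDl modn_small.
have mod_emb : chain_mod t (Ordinal (lt_emb o)) = o.
  by apply: val_inj; rewrite /= modnMDl modn_small.
by rewrite /= div_emb eqxx Eij eqxx -Eij mod_emb.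
Qed.

Lemma diag_emb_inj t s : (t <= s)%N -> injective (@diag_emb t s).
Proof.
move=> le_ts x y /(congr1 (diag_emb t)).
by rewrite !diag_emb_comp // !diag_emb_id.
Qed.

Definition matlim_pre := {t : nat & 'M[F]_(n t)}.

(* The transition maps are injective, so x and y agree at some later stage iff
   they already agree at the maximum of their indices. *)
Definition matlim_eqv (u v : matlim_pre) : bool :=
  let s := maxn (tag u) (tag v) in
  diag_emb s (tagged u) == diag_emb s (tagged v).

Lemma matlim_eqvE s (u v : matlim_pre) : (tag u <= s)%N -> (tag v <= s)%N ->
  matlim_eqv u v = (diag_emb s (tagged u) == diag_emb s (tagged v)).
Proof.
move=> le_us le_vs; have le_ms : (maxn (tag u) (tag v) <= s)%N by rewrite geq_max le_us.
rewrite /matlim_eqv -(inj_eq (diag_emb_inj le_ms)).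
by rewrite !diag_emb_comp ?leq_maxl ?leq_maxr.
Qed.

Lemma matlim_eqv_refl : reflexive matlim_eqv.
Proof. by move=> u; rewrite /matlim_eqv eqxx. Qed.

Lemma matlim_eqv_sym : symmetric matlim_eqv.
Proof. by move=> u v; rewrite /matlim_eqv maxnC eq_sym. Qed.

Lemma matlim_eqv_trans : transitive matlim_eqv.
Proof.
move=> v u w; set s := maxn (tag u) (maxn (tag v) (tag w)).
have le_us : (tag u <= s)%N by rewrite leq_maxl.
have le_vs : (tag v <= s)%N by rewrite /s !leq_max leqnn orbT.
have le_ws : (tag w <= s)%N by rewrite /s !leq_max leqnn !orbT.
by rewrite !(@matlim_eqvE s) // => /eqP ->.
Qed.

Canonical matlim_equiv :=
  EquivRel matlim_eqv matlim_eqv_refl matlim_eqv_sym matlim_eqv_trans.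

Definition matlim := {eq_quot matlim_equiv}.

HB.instance Definition _ := Choice.on matlim.

Definition matlim_in (t : nat) (x : 'M[F]_(n t)) : matlim :=
  \pi_matlim (Tagged (fun t => 'M[F]_(n t)) x).

Lemma matlim_in_emb t s (x : 'M[F]_(n t)) : (t <= s)%N ->
  matlim_in (diag_emb s x) = matlim_in x.
Proof.
move=> le_ts; apply/eqmodP; rewrite /= (@matlim_eqvE s) //=.
by rewrite diag_emb_comp.
Qed.

Lemma matlim_in_inj t : injective (@matlim_in t).
Proof.
move=> x y /eqmodP; rewrite /= (@matlim_eqvE t) //= !diag_emb_id.
by move/eqP.
Qed.

Lemma matlim_repr (a : matlim) : matlim_in (tagged (repr a)) = a.
Proof. by rewrite /matlim_in; case: (repr a) (reprK a) => t x /= ->. Qed.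

Lemma matlim_in_surj (a : matlim) : {t & {x : 'M[F]_(n t) | a = matlim_in x}}.
Proof. by exists (tag (repr a)), (tagged (repr a)); rewrite matlim_repr. Qed.

Definition matlim_op1 (f : forall t, 'M[F]_(n t) -> 'M[F]_(n t))
    (a : matlim) : matlim :=
  matlim_in (f _ (tagged (repr a))).

Definition matlim_op2 (f : forall t, 'M[F]_(n t) -> 'M[F]_(n t) -> 'M[F]_(n t))
    (a b : matlim) : matlim :=
  let s := maxn (tag (repr a)) (tag (repr b)) in
  matlim_in (f s (diag_emb s (tagged (repr a))) (diag_emb s (tagged (repr b)))).

Lemma matlim_op1E (f : forall t, 'M[F]_(n t) -> 'M[F]_(n t)) :
  (forall t s x, (t <= s)%N -> diag_emb s (f t x) = f s (diag_emb s x)) ->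
  forall t x, matlim_op1 f (matlim_in x) = matlim_in (f t x).
Proof.
move=> fE t x; rewrite /matlim_op1; have := matlim_repr (matlim_in x).
case: (repr _) => u y /=; set s := maxn t u.
have [le_ts le_us] : (t <= s)%N /\ (u <= s)%N by rewrite leq_maxl leq_maxr.
rewrite -(matlim_in_emb y le_us) -(matlim_in_emb x le_ts) => /matlim_in_inj E.
by rewrite -(matlim_in_emb _ le_us) -(matlim_in_emb _ le_ts) !fE // E.
Qed.

Lemma matlim_op2E (f : forall t, 'M[F]_(n t) -> 'M[F]_(n t) -> 'M[F]_(n t)) :
  (forall t s x y, (t <= s)%N ->
     diag_emb s (f t x y) = f s (diag_emb s x) (diag_emb s y)) ->
  forall t x y, matlim_op2 f (matlim_in x) (matlim_in y) = matlim_in (f t x y).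
Proof.
move=> fE t x y; rewrite /matlim_op2.
have := matlim_repr (matlim_in x); have := matlim_repr (matlim_in y).
case: (repr (matlim_in x)) (repr (matlim_in y)) => u x' [v y'] /=.
set m := maxn u v; set s := maxn t m.
have [le_ts le_ms] : (t <= s)%N /\ (m <= s)%N by rewrite leq_maxl leq_maxr.
have [le_um le_vm] : (u <= m)%N /\ (v <= m)%N by rewrite leq_maxl leq_maxr.
have [le_us le_vs] := (leq_trans le_um le_ms, leq_trans le_vm le_ms).
rewrite -(matlim_in_emb y' le_vs) -(matlim_in_emb y le_ts) => /matlim_in_inj Ey.
rewrite -(matlim_in_emb x' le_us) -(matlim_in_emb x le_ts) => /matlim_in_inj Ex.
rewrite -(matlim_in_emb _ le_ms) -(matlim_in_emb _ le_ts) !fE //.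
by rewrite !diag_emb_comp // Ex Ey.
Qed.

Definition matlim_add := matlim_op2 (fun t x y => x + y).
Definition matlim_mul := matlim_op2 (fun t x y => x *m y).
Definition matlim_opp := matlim_op1 (fun t x => - x).
Definition matlim_scale (c : F) := matlim_op1 (fun t x => c *: x).

Lemma matlim_addE t (x y : 'M[F]_(n t)) :
  matlim_add (matlim_in x) (matlim_in y) = matlim_in (x + y).
Proof. by apply: matlim_op2E => *; rewrite linearD. Qed.

Lemma matlim_mulE t (x y : 'M[F]_(n t)) :
  matlim_mul (matlim_in x) (matlim_in y) = matlim_in (x *m y).
Proof. by apply: matlim_op2E => *; rewrite diag_embM. Qed.

Lemma matlim_oppE t (x : 'M[F]_(n t)) :
  matlim_opp (matlim_in x) = matlim_in (- x).
Proof. by apply: matlim_op1E => *; rewrite linearN. Qed.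

Lemma matlim_scaleE c t (x : 'M[F]_(n t)) :
  matlim_scale c (matlim_in x) = matlim_in (c *: x).
Proof. by apply: matlim_op1E => *; rewrite linearZ. Qed.

Lemma matlim_in0 t : matlim_in (0 : 'M[F]_(n t)) = matlim_in (0 : 'M[F]_(n 0)).
Proof. by rewrite -(matlim_in_emb (0 : 'M[F]_(n 0)) (leq0n t)) linear0. Qed.

Lemma matlim_in1 t :
  matlim_in (1%:M : 'M[F]_(n t)) = matlim_in (1%:M : 'M[F]_(n 0)).
Proof. by rewrite -(matlim_in_emb (1%:M : 'M[F]_(n 0)) (leq0n t)) diag_emb1. Qed.

Lemma matlim_ind1 (P : matlim -> Prop) :
  (forall t (x : 'M[F]_(n t)), P (matlim_in x)) -> forall a, P a.
Proof. by move=> Pin a; have [t [x ->]] := matlim_in_surj a. Qed.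

Lemma matlim_ind3 (P : matlim -> matlim -> matlim -> Prop) :
  (forall t (x y z : 'M[F]_(n t)),
     P (matlim_in x) (matlim_in y) (matlim_in z)) ->
  forall a b c, P a b c.
Proof.
move=> Pin a b c; have [[t [x ->]] [u [y ->]]] := (matlim_in_surj a, matlim_in_surj b).
have [v [z ->]] := matlim_in_surj c; set s := maxn t (maxn u v).
have le_ts : (t <= s)%N by rewrite leq_maxl.
have le_us : (u <= s)%N by rewrite /s !leq_max leqnn orbT.
have le_vs : (v <= s)%N by rewrite /s !leq_max leqnn !orbT.
rewrite -(matlim_in_emb x le_ts) -(matlim_in_emb y le_us).
by rewrite -(matlim_in_emb z le_vs).
Qed.

Lemma matlim_ind2 (P : matlim -> matlim -> Prop) :
  (forall t (x y : 'M[F]_(n t)), P (matlim_in x) (matlim_in y)) ->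
  forall a b, P a b.
Proof.
move=> Pin a b; apply: (matlim_ind3 (P := fun a b _ => P a b)) (a) => t x y _.
exact: Pin.
Qed.

Lemma matlim_addA : associative matlim_add.
Proof. by apply: matlim_ind3 => t x y z; rewrite !matlim_addE addrA. Qed.

Lemma matlim_addC : commutative matlim_add.
Proof.
by apply: matlim_ind2 => t x y; rewrite !matlim_addE addrC.
Qed.

Lemma matlim_add0 : left_id (matlim_in (0 : 'M[F]_(n 0))) matlim_add.
Proof. by apply: matlim_ind1 => t x; rewrite -(matlim_in0 t) matlim_addE add0r. Qed.

Lemma matlim_addN :
  left_inverse (matlim_in (0 : 'M[F]_(n 0))) matlim_opp matlim_add.
Proof.
by apply: matlim_ind1 => t x; rewrite matlim_oppE matlim_addE addNr matlim_in0.
Qed.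

HB.instance Definition _ :=
  GRing.isZmodule.Build matlim matlim_addA matlim_addC matlim_add0 matlim_addN.

Lemma matlim_mulA : associative matlim_mul.
Proof. by apply: matlim_ind3 => t x y z; rewrite !matlim_mulE mulmxA. Qed.

Lemma matlim_mul1l : left_id (matlim_in (1%:M : 'M[F]_(n 0))) matlim_mul.
Proof. by apply: matlim_ind1 => t x; rewrite -(matlim_in1 t) matlim_mulE mul1mx. Qed.

Lemma matlim_mul1r : right_id (matlim_in (1%:M : 'M[F]_(n 0))) matlim_mul.
Proof. by apply: matlim_ind1 => t x; rewrite -(matlim_in1 t) matlim_mulE mulmx1. Qed.

Lemma matlim_mulDl : left_distributive matlim_mul +%R.
Proof.
apply: matlim_ind3 => t x y z.
by rewrite /+%R /= !(matlim_addE, matlim_mulE) mulmxDl.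
Qed.

Lemma matlim_mulDr : right_distributive matlim_mul +%R.
Proof.
apply: matlim_ind3 => t x y z.
by rewrite /+%R /= !(matlim_addE, matlim_mulE) mulmxDr.
Qed.

Lemma matlim_one_neq0 : matlim_in (1%:M : 'M[F]_(n 0)) != 0.
Proof.
apply/eqP=> /matlim_in_inj /matrixP E.
have /eqP := E (chain_mod 0 0) (chain_mod 0 0).
by rewrite !mxE eqxx oner_eq0.
Qed.

HB.instance Definition _ :=
  GRing.Zmodule_isNzRing.Build matlim matlim_mulA matlim_mul1l matlim_mul1r
    matlim_mulDl matlim_mulDr matlim_one_neq0.

Lemma matlim_scaleA a b (v : matlim) :
  matlim_scale a (matlim_scale b v) = matlim_scale (a * b) v.
Proof. by elim/matlim_ind1: v => t x; rewrite !matlim_scaleE scalerA. Qed.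

Lemma matlim_scale1 : left_id 1 matlim_scale.
Proof. by apply: matlim_ind1 => t x; rewrite matlim_scaleE scale1r. Qed.

Lemma matlim_scaleDr : right_distributive matlim_scale +%R.
Proof.
move=> c; apply: matlim_ind2 => t x y.
by rewrite /+%R /= !(matlim_addE, matlim_scaleE) scalerDr.
Qed.

Lemma matlim_scaleDl (v : matlim) : {morph matlim_scale^~ v : a b / a + b}.
Proof.
move=> a b; elim/matlim_ind1: v => t x.
by rewrite [X in _ = X]/+%R /= !(matlim_addE, matlim_scaleE) scalerDl.
Qed.

HB.instance Definition _ :=
  GRing.Zmodule_isLmodule.Build F matlim matlim_scaleA matlim_scale1
    matlim_scaleDr matlim_scaleDl.

Lemma matlim_scaleAl (k : F) (a b : matlim) : k *: (a * b) = (k *: a) * b.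
Proof.
apply: (matlim_ind2 (P := fun a b => k *: (a * b) = _)) a b => t x y.
by rewrite /( *:%R) /*%R /= !(matlim_scaleE, matlim_mulE) scalemxAl.
Qed.

HB.instance Definition _ :=
  GRing.Lmodule_isLalgebra.Build F matlim matlim_scaleAl.

Lemma matlim_scaleAr (k : F) (a b : matlim) : k *: (a * b) = a * (k *: b).
Proof.
apply: (matlim_ind2 (P := fun a b => k *: (a * b) = _)) a b => t x y.
by rewrite /( *:%R) /*%R /= !(matlim_scaleE, matlim_mulE) scalemxAr.
Qed.

HB.instance Definition _ :=
  GRing.Lalgebra_isAlgebra.Build F matlim matlim_scaleAr.

Lemma matlim_in_is_linear t : linear (@matlim_in t).
Proof.
move=> c x y; rewrite /+%R /( *:%R) /= [X in _ = matlim_add X _]matlim_scaleE.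
by rewrite matlim_addE.
Qed.

HB.instance Definition _ t :=
  GRing.isLinear.Build F 'M[F]_(n t) matlim *:%R (@matlim_in t)
    (@matlim_in_is_linear t).

Lemma matlim_inM t (x y : 'M[F]_(n t)) :
  matlim_in (x *m y) = matlim_in x * matlim_in y.
Proof. by rewrite [RHS]matlim_mulE. Qed.

Lemma matlim_in_1 t : matlim_in (1%:M : 'M[F]_(n t)) = 1.
Proof. exact: matlim_in1. Qed.

End DirectLimit.

Arguments matlim_in {F n} t x.
Arguments matlim_in_surj {F n} a.

Section Gradings.

Variables (F : fieldType) (G : groupType).

(* The group law of G is [*%g]: it need not be commutative, whereas the
   library's additive structures are.  The multiplication of A is a separate
   argument because 'M_m is an [algType] only when m is a successor. *)
Record is_grading (A : lmodType F) (mul : A -> A -> A) (D : G -> A -> Prop) :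
    Prop := IsGrading {
  grading0 : forall g, D g 0;
  gradingP : forall g (c : F) a b, D g a -> D g b -> D g (c *: a + b);
  gradingM : forall g h a b, D g a -> D h b -> D (g * h)%g (mul a b);
  grading_span : forall a, exists (m : nat) (g : 'I_m -> G) (b : 'I_m -> A),
    (forall i, D (g i) (b i)) /\ a = \sum_i b i;
  grading_direct : forall (m : nat) (g : 'I_m -> G) (b : 'I_m -> A),
    injective g -> (forall i, D (g i) (b i)) -> \sum_i b i = 0 ->
    forall i, b i = 0
}.

Definition is_elementary_mx (m : nat) (D : G -> 'M[F]_m -> Prop) : Prop :=
  is_grading (@mulmx F m m m) D /\
  exists g : 'I_m -> G,
    forall i j, D (g i * (g j)^-1)%g (delta_mx i j).

Variable n : divisor_chain.

Definition induced_grading (D : G -> matlim F n -> Prop) (t : nat) :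
    G -> 'M[F]_(n t) -> Prop :=
  fun g x => D g (matlim_in t x).

Definition is_elementary (D : G -> matlim F n -> Prop) : Prop :=
  is_grading *%R D /\ forall t, is_elementary_mx (@induced_grading D t).

Definition adic_unit t (w w' : word n t) : matlim F n :=
  matlim_in t (delta_mx (word_num w) (word_num w')).

(* The product h_{0,i_0} * h_{1,i_1} * ... * h_{t-1,i_{t-1}}
     * h_{t-1,i'_{t-1}}^-1 * ... * h_{1,i'_1}^-1 * h_{0,i'_0}^-1. *)
Definition word_degree (h : forall s : nat, 'I_(n s.+1 %/ n s) -> G)
    t (w w' : word n t) : G :=
  (\prod_(s < t) h s (w s) *
   \prod_(s < t) (h (rev_ord s) (w' (rev_ord s)))^-1)%g.

Definition has_degrees (D : G -> matlim F n -> Prop)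
    (h : forall s : nat, 'I_(n s.+1 %/ n s) -> G) : Prop :=
  forall t (w w' : word n t), D (word_degree h w w') (adic_unit w w').

End Gradings.

(* Main.v *)
Require Import Defs.
From mathcomp Require Import all_boot all_order all_algebra.
From mathcomp.classical Require Import boolp.

(* A grading gives a nonzero homogeneous element a single degree, and diagonal
   matrix units have degree 1, so e_{ii} x e_{jj} = x_{ij} e_{ij} has the same
   degree as any homogeneous x.  Applied to x = e_{w,0} of length t viewed at
   length t + 1, this gives deg e_{kw,k0} = deg e_{w,0} for every top digit k;
   with h_{t,k} := deg e_{k0,0}, the degree of e_{w,0} is the product of the
   h_{s,w_s}.  Conversely, any h assigns to each index i of stage t the product
   of the h_{s,i_s} over its digits, and deg e_{ij} := p_i p_j^-1 is compatible
   with the diagonal embeddings: indices in the same block share their upper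
   digits, whose contributions cancel. *)

Set Implicit Arguments.
Unset Strict Implicit.
Unset Printing Implicit Defensive.

Import GRing.Theory.
Local Open Scope ring_scope.

Lemma prodg_rev_inv (G : groupType) t (f : 'I_t -> G) :
  (\prod_(s < t) (f (rev_ord s))^-1 = (\prod_(s < t) f s)^-1)%g.
Proof.
elim: t f => [|t IHt] f; first by rewrite !big_ord0 invg1.
rewrite big_ord_recl big_ord_recr invgM; congr (_^-1 * _)%g.
  by congr f; apply: val_inj; rewrite /= subn1.
rewrite -IHt; apply: eq_bigr => s _; congr (f _)^-1%g.
by apply: val_inj; rewrite /= /bump add1n subSS.
Qed.

Lemma delta_mx_compress (R : comNzRingType) m (x : 'M[R]_m) i j :
  delta_mx i i *m x *m delta_mx j j = x i j *: delta_mx i j.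
Proof.
apply/matrixP=> a b; rewrite !mxE (bigD1 j) //= big1 => [|k /negbTE nkj].
  rewrite !mxE (bigD1 i) //= big1 => [|k /negbTE nki].
    by rewrite !mxE !eqxx addr0 andbT addr0; case: (a == i); case: (b == j);
      rewrite ?(mul1r, mul0r, mulr1, mulr0).
  by rewrite !mxE nki andbF mul0r.
by rewrite !mxE nkj mulr0.
Qed.

(** * General facts on gradings *)

Section Grading.

Variables (F : fieldType) (G : groupType) (A : lmodType F) (mul : A -> A -> A).
Variables (D : G -> A -> Prop) (Dgr : is_grading mul D).

Lemma gradingZ g (c : F) a : D g a -> D g (c *: a).
Proof.
by move=> Da; rewrite -[c *: a]addr0; apply: (gradingP Dgr) => //; apply: (grading0 Dgr).
Qed.

Lemma grading_sum g (I : finType) (P : pred I) (b : I -> A) :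
  (forall i, P i -> D g (b i)) -> D g (\sum_(i | P i) b i).
Proof.
move=> Db; apply: (big_ind (D g)) => //; first exact: (grading0 Dgr).
by move=> x y Dx Dy; rewrite -[x]scale1r; apply: (gradingP Dgr).
Qed.

(** If [g] and [h] differed, then [a] in degree [g] and [- a] in degree [h] would sum to zero,
    against directness. *)
Lemma grading_deg_uniq g h a : a != 0 -> D g a -> D h a -> g = h.
Proof.
move=> nz_a Dg Dh; have [//|/eqP ne_gh] := eqVneq g h; case/eqP: nz_a.
pose u (i : 'I_2) := if i == 0 then g else h.
pose b (i : 'I_2) := if i == 0 then a else - a.
apply: (grading_direct Dgr (g := u) (b := b) _ _ _ 0) => [i j|i|].
- rewrite /u; case: i j => [[|[|//]] i] [[|[|//]] j] //=; last 1 first.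
  + by move=> _; apply: val_inj.
  + by move=> _; apply: val_inj.
  + by move/esym.
- by rewrite /u /b; case: (i == 0); rewrite // -scaleN1r; apply: gradingZ.
- by rewrite big_ord_recl big_ord1 /b /= subrr.
Qed.

Lemma is_grading_iff (D' : G -> A -> Prop) :
  (forall g a, D' g a <-> D g a) -> is_grading mul D'.
Proof.
by move=> D'E; rewrite (_ : D' = D) //; apply/funext => g; apply/funext => a; apply/propext.
Qed.

End Grading.

(** * The elementary grading of a matrix algebra attached to a tuple of group elements *)

Section PotentialGrading.

Variables (F : fieldType) (G : groupType) (m : nat) (p : 'I_m -> G).

(** Homogeneity is read off the support, so the zero matrix lies in every component. *)
Definition potential_grading (g : G) (x : 'M[F]_m) : Prop :=
  forall i j, x i j != 0 -> (p i * (p j)^-1)%g = g.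

Lemma potential_grading_delta i j :
  potential_grading (p i * (p j)^-1)%g (delta_mx i j).
Proof.
move=> a b; rewrite mxE; have [->|_] := eqVneq a i; last by rewrite eqxx.
by have [->|_] := eqVneq b j; last by rewrite eqxx.
Qed.

Lemma potential_gradingP : is_grading (@mulmx F m m m) potential_grading.
Proof.
split.
- by move=> g i j; rewrite mxE eqxx.
- move=> g c a b Da Db i j; rewrite !mxE => nz.
  have [a0|nz_a] := eqVneq (a i j) 0; last exact: Da.
  by apply: Db; rewrite a0 mulr0 add0r in nz.
- move=> g h a b Da Db i j; rewrite mxE => nz.
  (* A nonzero entry of the product has a nonzero term, and [p k] cancels between its two
     degrees. *)
  have [k nzk] : exists k, a i k * b k j != 0.
    apply/existsP; apply: contraNT nz => /existsPn all0; rewrite big1 // => k _.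
    by apply/eqP; move: (all0 k); rewrite negbK.
  rewrite mulf_eq0 negb_or in nzk; have /andP[/Da <- /Db <-] := nzk.
  by rewrite mulgA mulgVK.
- move=> a; exists #|{: 'I_m * 'I_m}|.
  exists (fun u => p (enum_val u).1 * (p (enum_val u).2)^-1)%g.
  exists (fun u => a (enum_val u).1 (enum_val u).2 *: delta_mx (enum_val u).1 (enum_val u).2).
  split=> [u r c|]; last first.
    rewrite [LHS]matrix_sum_delta pair_big /=.
    rewrite (reindex (@enum_val _ {: 'I_m * 'I_m})) //=.
    by apply: onW_bij; apply: enum_val_bij.
  rewrite mxE mulf_eq0 negb_or => /andP[_]; exact: potential_grading_delta.
- move=> k g b inj_g Db sum0 u; apply/matrixP=> i j; rewrite mxE.
  have /matrixP/(_ i j) := sum0; rewrite summxE mxE (bigD1 u) //=.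
  have [//|/Db gu] := eqVneq (b u i j) 0.
  (* Only one degree is possible at position (i, j) and [g] is injective, so no other [b v] has a
     nonzero entry there. *)
  rewrite big1 ?addr0 // => v /eqP ne_vu; apply/eqP; apply: contra_notT ne_vu.
  by move/Db=> gv; apply: inj_g; rewrite -gu -gv.
Qed.

End PotentialGrading.

(** * Mixed-radix digits and words *)

Section Digits.

Variable n : divisor_chain.

Lemma digit_base_gt0 s : (0 < n s.+1 %/ n s)%N.
Proof. by rewrite divn_gt0 ?chain_gt0 // ltnW // chain_lt. Qed.

(** Taking any natural number [i], rather than an index of a fixed stage, lets digits be compared
    across stages. *)
Definition digit s (i : nat) : 'I_(n s.+1 %/ n s) :=
  Ordinal (ltn_pmod (i %/ n s) (digit_base_gt0 s)).

Lemma digit_modn s t i : (s < t)%N -> digit s (i %% n t) = digit s i.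
Proof.
move=> lt_st; apply: val_inj; rewrite /= !modn_divl divnK ?chain_dvd //.
by rewrite modn_dvdm // chain_dvd_le.
Qed.

Lemma digit_eq_div s t i j : (t <= s)%N ->
  (i %/ n t)%N = (j %/ n t)%N -> digit s i = digit s j.
Proof.
move=> le_ts Eij; apply: val_inj => /=; congr (_ %% _)%N.
by rewrite -(divnK (chain_dvd_le n le_ts)) mulnC !divnMA Eij.
Qed.

Lemma sum_digit t i : (\sum_(s < t) digit s i * n s = i %% n t)%N.
Proof.
elim: t => [|t IHt]; first by rewrite big_ord0 chain0 modn1.
rewrite big_ord_recr /= IHt -(modn_dvdm i (chain_dvd n t)) addnC.
by rewrite modn_divl (divnK (chain_dvd n t)) -divn_eq.
Qed.

Lemma word_num_surj t (i : 'I_(n t)) : exists w : word n t, word_num w = i.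
Proof.
exists (fun s => digit s i); apply: val_inj => /=.
by rewrite (sum_digit t i) modn_small.
Qed.

Definition low_word t (w : word n t.+1) : word n t :=
  fun s => w (widen_ord (leqnSn t) s).

Lemma word_num_recr t (w : word n t.+1) :
  word_num w = (word_num (low_word w) + w ord_max * n t)%N :> nat.
Proof. by rewrite /= big_ord_recr. Qed.

Lemma word_num_mod t (w : word n t.+1) :
  (word_num w %% n t)%N = word_num (low_word w).
Proof. by rewrite word_num_recr addnC modnMDl modn_small. Qed.

Lemma word_num_div t (w : word n t.+1) : (word_num w %/ n t)%N = w ord_max.
Proof. rewrite word_num_recr addnC divnMDl ?chain_gt0 //.
by rewrite (divn_small (ltn_ord _)) addn0. Qed.

Lemma digit_word_num t (w : word n t.+1) : digit t (word_num w) = w ord_max.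
Proof.
apply: val_inj; rewrite -[LHS]/(word_num w %/ n t %% (n t.+1 %/ n t))%N.
by rewrite word_num_div modn_small.
Qed.

End Digits.

Lemma matlim_in_neq0 (F : fieldType) (n : divisor_chain) t (x : 'M[F]_(n t)) :
  x != 0 -> matlim_in t x != 0.
Proof. by rewrite -(inj_eq (@matlim_in_inj F n t)) linear0. Qed.

Lemma matlim_delta_neq0 (F : fieldType) (n : divisor_chain) t (i j : 'I_(n t)) :
  matlim_in t (delta_mx i j : 'M[F]_(n t)) != 0.
Proof.
apply: matlim_in_neq0; apply/eqP => /matrixP/(_ i j)/eqP.
by rewrite !mxE !eqxx oner_eq0.
Qed.

(** Reduces directness of a grading of the limit to directness at a single stage. *)
Lemma matlim_family (F : fieldType) (n : divisor_chain) m (b : 'I_m -> matlim F n) :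
  exists t (y : 'I_m -> 'M[F]_(n t)), forall i, b i = matlim_in t (y i).
Proof.
exists (\max_i tag (repr (b i)))%N.
exists (fun i => diag_emb _ (tagged (repr (b i)))) => i.
by rewrite matlim_in_emb ?matlim_repr // leq_bigmax.
Qed.

(** * From an elementary grading to the family [h] *)

Section ElementaryToDegrees.

Variables (F : fieldType) (G : groupType) (n : divisor_chain).
Variables (D : G -> matlim F n -> Prop) (Dgr : is_grading *%R D).

(** Used with [s = t.+1] to carry a degree to the next stage, and with [s = t] to isolate one
    entry. *)
Lemma grading_compress s t (g : G) (x : 'M[F]_(n t)) (i j : 'I_(n s)) :
  (t <= s)%N -> D 1%g (matlim_in s (delta_mx i i)) ->
  D 1%g (matlim_in s (delta_mx j j)) -> D g (matlim_in t x) ->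
  D g (matlim_in s (diag_emb s x i j *: delta_mx i j)).
Proof.
move=> le_ts Di Dj Dx; rewrite -delta_mx_compress !matlim_inM matlim_in_emb //.
rewrite -[g]mulg1 -[g]mul1g.
by do 2?apply: (gradingM Dgr).
Qed.

Lemma elementary_has_degrees :
  (forall t, is_elementary_mx (@induced_grading F G n D t)) ->
  exists h : forall s : nat, 'I_(n s.+1 %/ n s) -> G, has_degrees D h.
Proof.
(* The tuples [q t] are chosen stage by stage, with no relation between stages; only their quotients
   are meaningful. *)
move=> Del; pose q t := projT1 (cid (Del t).2).
have Dq t (i j : 'I_(n t)) : D (q t i * (q t j)^-1)%g (matlim_in t (delta_mx i j)).
  by rewrite /q; case: cid => u; apply.
have D1 t (i : 'I_(n t)) : D 1%g (matlim_in t (delta_mx i i)).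
  by rewrite -(mulgV (q t i)).
pose z t := chain_mod n t 0.
(* The index [k * n s] is the word with top digit [k] and zeros below. *)
pose h s (k : 'I_(n s.+1 %/ n s)) : G :=
  (q s.+1 (chain_mod n s.+1 (k * n s)) * (q s.+1 (z s.+1))^-1)%g.
have degE t (w : word n t) :
    D (\prod_(s < t) h s (w s))%g (matlim_in t (delta_mx (word_num w) (z t))).
  elim: t w => [|t IHt] w.
    rewrite big_ord0 (_ : z 0%N = word_num w) //; apply: val_inj.
    by rewrite /= big_ord0 mod0n.
  rewrite big_ord_recr /=; set k := chain_mod n t.+1 (w ord_max * n t).
  have Ek : k = (w ord_max * n t)%N :> nat.
    by rewrite /= modn_small // (leq_ltn_trans _ (ltn_ord (word_num w))) //
      word_num_recr leq_addl.
  (* Factor the unit through [k], the word that keeps the top digit of [w] and has zeros below: the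
     right factor has degree [h t (w ord_max)], the left one comes from stage [t]. *)
  rewrite -(mul_delta_mx k) matlim_inM; apply: (gradingM Dgr); last exact: Dq.
  have := grading_compress (leqnSn t) (D1 _ (word_num w)) (D1 _ k) (IHt (low_word w)).
  (* Both [word_num w] and [k] lie in block [w ord_max], with residues the low word and 0. *)
  suff -> : diag_emb t.+1 (delta_mx (word_num (low_word w)) (z t)) (word_num w) k = 1 :> F.
    by rewrite scale1r.
  have -> : word_num (low_word w) = chain_mod n t (word_num w).
    exact/val_inj/esym/word_num_mod.
  have -> : z t = chain_mod n t k.
    apply: val_inj; rewrite -[RHS]/(k %% n t)%N Ek modnMl; exact: mod0n.
  by rewrite !mxE word_num_div Ek mulnK ?chain_gt0 // !eqxx.
exists h => t w w'; rewrite /word_degree (prodg_rev_inv (fun s => h s (w' s))).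
(* Each product of [h] equals [q t] at the word times the inverse of [q t] at 0; the latter cancels
   in the quotient. *)
have Eh v := grading_deg_uniq Dgr (matlim_delta_neq0 F _ _) (degE t v) (Dq t _ _).
rewrite !Eh invgM invgK mulgA mulgVK; exact: Dq.
Qed.

End ElementaryToDegrees.

(** * From a family [h] to its elementary grading *)

Section DegreesToElementary.

Variables (F : fieldType) (G : groupType) (n : divisor_chain).
Variable h : forall s : nat, 'I_(n s.+1 %/ n s) -> G.

Definition potential t (i : nat) : G := (\prod_(s < t) h (digit n s i))%g.

Lemma potentialS t i : potential t.+1 i = (potential t i * h (digit n t i))%g.
Proof. exact: big_ord_recr. Qed.

Lemma potential_modn t i : potential t (i %% n t) = potential t i.
Proof. by apply: eq_bigr => s _; rewrite digit_modn. Qed.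

(** Digits at positions [t] and above depend only on the block number; being rightmost in the
    products, they cancel in the middle, one per induction step. *)
Lemma potential_emb t s i j : (t <= s)%N -> (i %/ n t)%N = (j %/ n t)%N ->
  (potential s i * (potential s j)^-1 = potential t i * (potential t j)^-1)%g.
Proof.
move=> + Eij; elim: s => [|s IHs]; first by rewrite leqn0 => /eqP->.
rewrite leq_eqVlt ltnS => /predU1P[->//|le_ts].
rewrite -IHs // !potentialS (digit_eq_div le_ts Eij).
by rewrite invgM mulgA mulgK.
Qed.

Lemma potential_word_num t (w : word n t) :
  potential t (word_num w) = (\prod_(s < t) h (w s))%g.
Proof.
elim: t w => [|t IHt] w; first by rewrite /potential !big_ord0.
rewrite potentialS digit_word_num [RHS]big_ord_recr; congr (_ * _)%g.
by rewrite -potential_modn word_num_mod IHt.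
Qed.

Lemma word_degree_potential t (w w' : word n t) :
  word_degree h w w' =
    (potential t (word_num w) * (potential t (word_num w'))^-1)%g.
Proof.
by rewrite !potential_word_num /word_degree (prodg_rev_inv (fun s => h (w' s))).
Qed.

Definition stage_grading t : G -> 'M[F]_(n t) -> Prop :=
  potential_grading (fun i => potential t i).

Lemma stage_grading_emb t s g (x : 'M[F]_(n t)) : (t <= s)%N ->
  stage_grading g (diag_emb s x) <-> stage_grading g x.
Proof.
move=> le_ts; split=> Dx i j => [nz|].
  (* [x] is recovered as the top left block of its image. *)
  have lt_s (k : 'I_(n t)) : (k < n s)%N.
    by apply: leq_trans (ltn_ord k) (dvdn_leq (chain_gt0 n s) (chain_dvd_le n le_ts)).
  have := Dx (Ordinal (lt_s i)) (Ordinal (lt_s j)); rewrite mxE /= !divn_small // eqxx.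
  rewrite (@potential_emb t s) ?divn_small //; apply.
  by rewrite !chain_mod_id.
rewrite mxE; case: ifP => [/eqP Eij nz|_]; last by rewrite eqxx.
by rewrite (potential_emb le_ts Eij) -(Dx _ _ nz) /= !potential_modn.
Qed.

Definition limit_grading (g : G) (a : matlim F n) : Prop :=
  exists t (x : 'M[F]_(n t)), a = matlim_in t x /\ stage_grading g x.

Lemma limit_gradingE t g (x : 'M[F]_(n t)) :
  limit_grading g (matlim_in t x) <-> stage_grading g x.
Proof.
split=> [[u [y [+ Dy]]]|Dx]; last by exists t, x.
have [le_t le_u] := (leq_maxl t u, leq_maxr t u).
rewrite -(matlim_in_emb x le_t) -(matlim_in_emb y le_u) => /matlim_in_inj E.
by apply/(stage_grading_emb _ _ le_t); rewrite E; apply/stage_grading_emb.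
Qed.

Lemma limit_gradingP : is_grading *%R limit_grading.
Proof.
have stageP t : is_grading (@mulmx F _ _ _) (@stage_grading t) := potential_gradingP _ _.
split.
- move=> g; rewrite -(linear0 (@matlim_in F n 0)); apply/limit_gradingE.
  exact: (grading0 (stageP _)).
- move=> g c; apply: matlim_ind2 => t x y /limit_gradingE Dx /limit_gradingE Dy.
  by rewrite -linearP; apply/limit_gradingE; apply: (gradingP (stageP t)).
- move=> g g'; apply: matlim_ind2 => t x y /limit_gradingE Dx /limit_gradingE Dy.
  by rewrite -matlim_inM; apply/limit_gradingE; apply: (gradingM (stageP t)).
- apply: matlim_ind1 => t x; have [m [g [b [Db ->]]]] := grading_span (stageP t) x.
  exists m, g, (fun i => matlim_in t (b i)); rewrite linear_sum; split=> // i.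
  exact/limit_gradingE.
- move=> m g b inj_g Db; have [t [y Eb]] := matlim_family b.
  under eq_bigr do rewrite Eb.
  rewrite -linear_sum -(linear0 (@matlim_in F n t)) => /matlim_in_inj sum0 i.
  rewrite Eb (grading_direct (stageP t) inj_g _ sum0) // => k.
  by apply/limit_gradingE; rewrite -Eb.
Qed.

Lemma limit_grading_elementary : is_elementary limit_grading.
Proof.
split=> [|t]; first exact: limit_gradingP.
split.
  apply: (is_grading_iff (potential_gradingP F (fun i : 'I_(n t) => potential t i))).
  by move=> g x; apply: limit_gradingE.
exists (fun i => potential t i) => i j; apply/limit_gradingE.
exact: potential_grading_delta.
Qed.

Lemma limit_grading_has_degrees : has_degrees limit_grading h.
Proof.
move=> t w w'; rewrite word_degree_potential; apply/limit_gradingE.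
exact: potential_grading_delta.
Qed.

(** The degrees of the matrix units determine the whole grading, because compression makes each
    entry of a homogeneous matrix homogeneous of the same degree. *)
Lemma limit_grading_unique (D : G -> matlim F n -> Prop) :
  is_grading *%R D -> has_degrees D h -> forall g a, D g a <-> limit_grading g a.
Proof.
move=> Dgr Dh g; apply: matlim_ind1 => t x.
have Ddelta (i j : 'I_(n t)) :
    D (potential t i * (potential t j)^-1)%g (matlim_in t (delta_mx i j)).
  have [[w <-] [w' <-]] := (word_num_surj i, word_num_surj j).
  by rewrite -word_degree_potential; apply: Dh.
have D1 (i : 'I_(n t)) : D 1%g (matlim_in t (delta_mx i i)).
  by rewrite -(mulgV (potential t i)).
rewrite limit_gradingE; split=> [Dx i j nz|Dx].
  have := grading_compress Dgr (leqnn t) (D1 i) (D1 j) Dx.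
  rewrite diag_emb_id => /(gradingZ Dgr (x i j)^-1).
  rewrite linearZ scalerA mulVf // scale1r.
  exact: (grading_deg_uniq Dgr (matlim_delta_neq0 F i j)).
rewrite [x]matrix_sum_delta linear_sum; apply: (grading_sum Dgr) => i _.
rewrite linear_sum; apply: (grading_sum Dgr) => j _; rewrite linearZ /=.
(* The support condition fixes the degree of the unit only at nonzero entries. *)
have [->|/Dx <-] := eqVneq (x i j) 0; first by rewrite scale0r; apply: (grading0 Dgr).
by apply: (gradingZ Dgr); apply: Ddelta.
Qed.

End DegreesToElementary.

Theorem proposition5p7 (F : fieldType) (G : groupType)
    (N : supernatural) (n : divisor_chain) (hN : is_supernat_lcm n N) :
  (forall D : G -> matlim F n -> Prop, is_elementary D ->
     exists h : forall s : nat, 'I_(n s.+1 %/ n s) -> G, has_degrees D h) /\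
  (forall h : forall s : nat, 'I_(n s.+1 %/ n s) -> G,
     exists D : G -> matlim F n -> Prop,
       [/\ is_elementary D, has_degrees D h &
           forall D' : G -> matlim F n -> Prop,
             is_grading *%R%R D' -> has_degrees D' h ->
             forall g a, D' g a <-> D g a]).
Proof.
split=> [D [Dgr Del]|h]; first exact: elementary_has_degrees Del.
exists (limit_grading h); split.
- exact: limit_grading_elementary.
- exact: limit_grading_has_degrees.
- exact: limit_grading_unique.
Qed.
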